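(* Let $(f,k)$ be an instance of size-constrained monotone submodular maximization with $k<\psi/\ell$, in the MapReduce model with $\ell$ machines each storing at most $\psi$ elements. Let $\mathrm{Alg}$ be a randomized algorithm which satisfies the randomized consistency property, has approximation ratio $\alpha$, query complexity $\Phi(n)$ and adaptivity $\Psi(n)$. Then the algorithm R-DASH with $\mathrm{Alg}$ in place of LAG returns a set $V$ using two MapReduce rounds, $2\Psi(n/\ell)$ adaptive rounds, $(\ell+1)\Phi(n/\ell)$ total queries and $O(n)$ communication complexity, such that $\mathbb E[f(V)]\ge\frac{\alpha}{2}\mathrm{OPT}$.
   Context: $\mathcal N$ is a ground set of size $n$, $f:2^{\mathcal N}\to\mathbb R_{\ge0}$ monotone submodular, $\mathrm{OPT}=\max\{f(S):|S|\le k\}$. MapReduce model: data distributed on $\ell$ machines, each holding at most $\psi$ elements, $\psi\ell=O(n)$; after each (MapReduce) round a machine may send $O(\psi)$ data to others; $\ell\le n^{1-c}$ for a constant $c\ge1/2$. Adaptive rounds: sequential rounds of polynomially many queries, each depending only on answers of previous rounds. Randomized consistency property of an algorithm $\mathrm{Alg}(Y,\mathbf q)$ (input set $Y$, fixed random bits $\mathbf q$): for all disjoint $A,B\subseteq\mathcal N$, if $b\notin\mathrm{Alg}(A\cup\{b\},\mathbf q)$ for all $b\in B$ and $\mathrm{Alg}(A,\mathbf q)$ terminates successfully, then $\mathrm{Alg}(A\cup B,\mathbf q)$ terminates successfully and equals $\mathrm{Alg}(A,\mathbf q)$. Approximation ratio $\alpha$: on input set $Y$ it returns a subset of $Y$ of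 size at most $k$ with value at least $\alpha\max\{f(Z):Z\subseteq Y,|Z|\le k\}$. R-DASH with $\mathrm{Alg}$: assign each $e\in\mathcal N$ to a machine chosen uniformly at random; on each machine $i$ with assigned set $\mathcal N_i$, compute $S_i=\mathrm{Alg}(\mathcal N_i,\mathbf q)$ (same fixed random bits $\mathbf q$ on every call) and send it to the primary machine; there form $S=\bigcup_{i=1}^\ell S_i$, compute $T=\mathrm{Alg}(S,\mathbf q)$, and return $V=\arg\max\{f(T),f(S_1)\}$.
   Formalization: The 2Ψ(n/ℓ), (ℓ+1)Φ(n/ℓ) bounds fail when loads exceed n/ℓ; proved with m ≥ ψ bounding all loads in place of n/ℓ, and with m = K·n/ℓ with probability ≥ 1−1/n; they cover calls of Alg, the final argmax adding one round and two queries; Alg succeeds almost surely. *)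

(* Defs.v *)
From mathcomp Require Import all_boot all_order all_algebra.
From mathcomp Require Import boolp reals.

Set Implicit Arguments.
Unset Strict Implicit.
Unset Printing Implicit Defensive.

Import Order.TTheory GRing.Theory Num.Theory.
Local Open Scope ring_scope.

Section Submodular.
Context {R : realType} {N : finType}.
Implicit Types (f : {set N} -> R) (k : nat) (A B Y Z : {set N}).

Definition monotone_set_fun f := forall A B, A \subset B -> f A <= f B.

Definition submodular f := forall A B (x : N),
  A \subset B -> x \notin B -> f (x |: B) - f B <= f (x |: A) - f A.

(* The base value 0 of the maximum is harmless: f is nonnegative and Z = set0
   is always a candidate. *)
Definition opt_on f k Y : R :=
  \big[Num.max/0]_(Z : {set N} | (Z \subset Y) && (#|Z| <= k)%N) f Z.

Definition opt f k : R := opt_on f k [set: N].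

End Submodular.

(* Computations with access to a value oracle, organised in adaptive rounds:
   [Query qs c] submits all the queries [qs] simultaneously and continues with
   [c], which is given the list of answers. Everything a computation does can
   thus depend on the objective only through the answers of earlier rounds. *)
Inductive oracle_comp (N : finType) (R A : Type) : Type :=
| Return of A
| Query of seq {set N} & (seq R -> oracle_comp N R A).
Arguments Return {N R A}.
Arguments Query {N R A}.

Section OracleComputation.
Context {R : Type} {N : finType}.
Variable f : {set N} -> R.

Fixpoint run {A : Type} (c : oracle_comp N R A) : A :=
  match c with
  | Return a => a
  | Query qs c' => run (c' (map f qs))
  end.

Fixpoint rounds {A : Type} (c : oracle_comp N R A) : nat :=
  match c with
  | Return _ => 0%N
  | Query qs c' => (rounds (c' (map f qs))).+1
  end.

Fixpoint queries {A : Type} (c : oracle_comp N R A) : nat :=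
  match c with
  | Return _ => 0%N
  | Query qs c' => (size qs + queries (c' (map f qs)))%N
  end.

End OracleComputation.

Fixpoint oc_bind {N : finType} {R A B : Type} (c : oracle_comp N R A)
    (g : A -> oracle_comp N R B) : oracle_comp N R B :=
  match c with
  | Return a => g a
  | Query qs c' => Query qs (fun ans => oc_bind (c' ans) g)
  end.

(* A randomized algorithm takes an input set and the random bits; it ends with
   [Some T] when it terminates successfully and with [None] when it fails. *)
Definition rand_alg (N : finType) (R Q : Type) :=
  {set N} -> Q -> oracle_comp N R (option {set N}).

Section RandomizedAlgorithm.
Context {R : realType} {N : finType} {Q : Type}.
Variables (f : {set N} -> R) (Alg : rand_alg N R Q).

Definition succeeds (Y : {set N}) (q : Q) : bool := isSome (run f (Alg Y q)).

(* The set returned by Alg; a failed run returns no element. *)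
Definition output (Y : {set N}) (q : Q) : {set N} :=
  odflt set0 (run f (Alg Y q)).

Definition randomized_consistency := forall (q : Q) (A B : {set N}),
  [disjoint A & B] ->
  (forall b, b \in B -> b \notin output (b |: A) q) ->
  succeeds A q ->
  succeeds (A :|: B) q /\ output (A :|: B) q = output A q.

Definition approx_ratio (k : nat) (alpha : R) := forall (Y : {set N}) (q : Q),
  succeeds Y q ->
  [/\ output Y q \subset Y, (#|output Y q| <= k)%N
    & alpha * opt_on f k Y <= f (output Y q)].

(* Complexities are worst case over the inputs with at most m elements; m is
   real so that they can be evaluated at n / l. *)
Definition query_complexity (Phi : R -> R) := forall (m : R) (Y : {set N}) q,
  #|Y|%:R <= m -> (queries f (Alg Y q))%:R <= Phi m.

Definition adaptivity (Psi : R -> R) := forall (m : R) (Y : {set N}) q,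
  #|Y|%:R <= m -> (rounds f (Alg Y q))%:R <= Psi m.

End RandomizedAlgorithm.

(* A MapReduce round on l machines. Machine i, storing A, sends the elements
   [mr_send i A j] to machine j; then each machine j runs a local oracle
   computation on what it received (indexed by sender), whose result is all that
   it stores afterwards. To keep data, a machine sends it to itself; this is
   charged as communication too. *)
Record mr_round (N : finType) (R : Type) (l : nat) := MRRound {
  mr_send : 'I_l -> {set N} -> 'I_l -> {set N};
  mr_compute : 'I_l -> ('I_l -> {set N}) -> oracle_comp N R {set N}
}.

Section MapReduce.
Context {R : realType} {N : finType} {l : nat}.
Variable f : {set N} -> R.
Implicit Types (r : mr_round N R l) (p : seq (mr_round N R l))
  (s : 'I_l -> {set N}).

Definition mr_inbox r s (j : 'I_l) : 'I_l -> {set N} :=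
  fun i => mr_send r i (s i) j.

Definition mr_local r s (j : 'I_l) := mr_compute r j (mr_inbox r s j).

Definition mr_step r s : 'I_l -> {set N} := fun j => run f (mr_local r s j).

Fixpoint mr_exec p s : 'I_l -> {set N} :=
  if p is r :: p' then mr_exec p' (mr_step r s) else s.

Fixpoint mr_communication p s : nat :=
  if p is r :: p' then
    (\sum_i \sum_j #|mr_send r i (s i) j|
       + mr_communication p' (mr_step r s))%N
  else 0%N.

(* Within a MapReduce round the machines query the oracle in parallel. *)
Fixpoint mr_adaptive_rounds p s : nat :=
  if p is r :: p' then
    (\max_j rounds f (mr_local r s j)
       + mr_adaptive_rounds p' (mr_step r s))%N
  else 0%N.

Fixpoint mr_queries p s : nat :=
  if p is r :: p' then
    (\sum_j queries f (mr_local r s j) + mr_queries p' (mr_step r s))%N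
  else 0%N.

(* The execution of p from s fits on machines of capacity m: no machine ever
   stores, sends or receives more than m elements, and machines only handle
   elements that they hold. *)
Fixpoint mr_within (m : R) p s : Prop :=
  (forall i, #|s i|%:R <= m) /\
  if p is r :: p' then
    [/\ forall i j, mr_send r i (s i) j \subset s i,
        forall i, (\sum_j #|mr_send r i (s i) j|)%N%:R <= m,
        forall j, (\sum_i #|mr_inbox r s j i|)%N%:R <= m,
        forall j, mr_step r s j \subset \bigcup_i mr_inbox r s j i
      & mr_within m p' (mr_step r s)]
  else True.

End MapReduce.

Definition assignment (N : finType) (l : nat) := {ffun N -> 'I_l}.

Definition part {N : finType} {l : nat} (pi : assignment N l) (i : 'I_l) :
  {set N} := [set e | pi e == i].

(* Assigning each element independently and uniformly to one of the l machines
   is the uniform distribution on assignments. *)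
Definition assignment_mean {R : realType} {N : finType} {l : nat}
    (X : assignment N l -> R) : R :=
  (\sum_(pi : assignment N l) X pi) / #|{: assignment N l}|%:R.

Definition assignment_prob {R : realType} {N : finType} {l : nat}
    (E : assignment N l -> Prop) : R :=
  assignment_mean (fun pi => `[< E pi >]%:R).

Section RDash.
Context {R : realType} {N : finType} {l : nat} {Q : Type}.
Variables (Alg : rand_alg N R Q) (i1 : 'I_l).
Implicit Types (pi : assignment N l) (q : Q).

Definition argmax2 (T S1 : {set N}) : oracle_comp N R {set N} :=
  Query [:: T; S1]
    (fun ans => Return (if nth 0 ans 1 <= nth 0 ans 0 then T else S1)).

(* R-DASH for a fixed outcome of its randomness; i1 is both the machine
   computing S_1 and the primary machine. *)
Definition rdash pi q : seq (mr_round N R l) :=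
  [:: MRRound
        (fun _ A j => A :&: part pi j)
        (fun _ inbox => oc_bind (Alg (\bigcup_i inbox i) q)
           (fun o => Return (odflt set0 o)));
      MRRound
        (fun _ A j => if j == i1 then A else set0)
        (fun j inbox =>
           if j == i1 then
             oc_bind (Alg (\bigcup_i inbox i) q)
               (fun o => argmax2 (odflt set0 o) (inbox i1))
           else Return set0)].

Variable f : {set N} -> R.

(* The data are initially placed on the machines according to loc. *)
Definition rdash_set (loc : assignment N l) pi q : {set N} :=
  mr_exec f (rdash pi q) (part loc) i1.

Definition rdash_union pi q : {set N} :=
  \bigcup_(i < l) output f Alg (part pi i) q.

(* Costs of the l + 1 calls to Alg, without the final comparison of f(T) and
   f(S_1). *)
Definition alg_rounds pi q : nat :=
  (\max_(i < l) rounds f (Alg (part pi i) q)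
     + rounds f (Alg (rdash_union pi q) q))%N.

Definition alg_queries pi q : nat :=
  (\sum_(i < l) queries f (Alg (part pi i) q)
     + queries f (Alg (rdash_union pi q) q))%N.

(* Resources used when the machines have capacity m. The complete execution
   costs one adaptive round of two queries more than the calls to Alg, namely
   the final comparison. *)
Definition rdash_resources (Phi Psi : R -> R) (loc : assignment N l) (m : R)
    pi q : Prop :=
  [/\ mr_within f m (rdash pi q) (part loc),
      (alg_rounds pi q)%:R <= 2 * Psi m,
      (alg_queries pi q)%:R <= (l.+1)%:R * Phi m,
      mr_adaptive_rounds f (rdash pi q) (part loc) = (alg_rounds pi q).+1
    & mr_queries f (rdash pi q) (part loc) = (alg_queries pi q).+2].

End RDash.

(* Main.v *)
Require Import Defs.
From mathcomp Require Import all_boot all_order all_algebra.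
From mathcomp Require Import all_classical all_reals all_analysis.
From mathcomp Require Import perm lra.

Set Implicit Arguments.
Unset Strict Implicit.
Unset Printing Implicit Defensive.

Import Order.TTheory GRing.Theory Num.Theory.
Local Open Scope ring_scope.

(** Fix random bits on which every run of Alg succeeds, and an optimal set O.
    Let A be the elements o of O selected on their own machine, and B those that
    Alg does not select from o |: N_1. The approximation ratio on the primary
    machine gives f(T) >= alpha f(A); consistency gives Alg(N_1 :|: B) = Alg(N_1),
    hence f(S_1) >= alpha f(B). By symmetry of the machines, P(o in A) and
    P(o in B) add up to 1, and bounding f from below by a modular function exact
    at O gives E f(A) + E f(B) >= f(O).

    For the memory bound, E exp(load) <= exp((e - 1) n / l) on each machine, and
    l <= sqrt n makes the union bound over the machines sum to at most 1 / n. *)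

(** * Result and cost of composed oracle computations *)

Section Bind.
Context {R : Type} {N : finType} {A B : Type}.
Variables (f : {set N} -> R).
Implicit Types (c : oracle_comp N R A) (g : A -> oracle_comp N R B).

Lemma run_bind c g : run f (oc_bind c g) = run f (g (run f c)).
Proof. by elim: c => [a|qs c IH] //=; rewrite IH. Qed.

Lemma rounds_bind c g :
  rounds f (oc_bind c g) = (rounds f c + rounds f (g (run f c)))%N.
Proof. by elim: c => [a|qs c IH] //=; rewrite IH. Qed.

Lemma queries_bind c g :
  queries f (oc_bind c g) = (queries f c + queries f (g (run f c)))%N.
Proof. by elim: c => [a|qs c IH] //=; rewrite IH addnA. Qed.

End Bind.

(** * Counting along the fibres of an assignment *)

Section Part.
Context {N : finType} {l : nat}.
Implicit Types (pi loc : assignment N l).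

Lemma sum_card_setI_part pi (A : {set N}) :
  (\sum_(i < l) #|A :&: part pi i| = #|A|)%N.
Proof.
rewrite -[RHS]sum1_card (partition_big pi xpredT) //=.
by apply: eq_bigr => i _; rewrite -sum1_card; apply: eq_bigl => x; rewrite !inE.
Qed.

Lemma bigcup_part_setI loc (A : {set N}) :
  \bigcup_(i < l) (part loc i :&: A) = A.
Proof.
apply/setP => x; apply/bigcupP/idP => [[i _ /setIP[]]//|xA].
by exists (loc x); rewrite // !inE eqxx.
Qed.

Lemma sum_card_sub_part pi (s : 'I_l -> {set N}) :
  (forall i, s i \subset part pi i) -> (\sum_(i < l) #|s i| <= #|N|)%N.
Proof.
move=> sp; rewrite -cardsT -(sum_card_setI_part pi).
by apply: leq_sum => i _; rewrite finset.setTI subset_leq_card.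
Qed.

End Part.

(** * Execution of R-DASH for fixed randomness: returned set, costs and memory *)

Section RDashExecution.
Context {R : realType} {N : finType} {l : nat} {Q : Type}.
Variables (f : {set N} -> R) (Alg : rand_alg N R Q) (i1 : 'I_l).
Variables (loc pi : assignment N l) (q : Q).

Let S i := output f Alg (part pi i) q.
Let T := output f Alg (rdash_union Alg f pi q) q.

Definition scatter : mr_round N R l :=
  MRRound (fun _ A j => A :&: part pi j)
    (fun _ inbox => oc_bind (Alg (\bigcup_i inbox i) q)
       (fun o => Return (odflt finset.set0 o))).

Definition gather : mr_round N R l :=
  MRRound (fun _ A j => if j == i1 then A else finset.set0)
    (fun j inbox =>
       if j == i1 then
         oc_bind (Alg (\bigcup_i inbox i) q)
           (fun o => argmax2 (odflt finset.set0 o) (inbox i1))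
       else Return finset.set0).

Local Arguments mr_local : simpl never.

Lemma rdashE : rdash Alg i1 pi q = [:: scatter; gather].
Proof. by []. Qed.

Lemma mr_local_scatter j : mr_local scatter (part loc) j =
  oc_bind (Alg (part pi j) q) (fun o => Return (odflt finset.set0 o)).
Proof. by rewrite /mr_local /mr_inbox /= bigcup_part_setI. Qed.

Lemma mr_step_scatter : mr_step f scatter (part loc) = S.
Proof.
by apply/funext => j; rewrite /mr_step mr_local_scatter run_bind.
Qed.

Lemma mr_inbox_gather j :
  mr_inbox gather S j = fun i => if j == i1 then S i else finset.set0.
Proof. by []. Qed.

Lemma mr_local_gather (j : 'I_l) : mr_local gather S j =
  if j == i1 then
    oc_bind (Alg (rdash_union Alg f pi q) q)
      (fun o => argmax2 (odflt finset.set0 o) (S i1))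
  else Return finset.set0.
Proof.
rewrite /mr_local mr_inbox_gather /=.
by case: (j == i1).
Qed.

Lemma mr_step_gather : mr_step f gather S =
  fun j => if j == i1 then if f (S i1) <= f T then T else S i1 else finset.set0.
Proof.
apply/funext => j; rewrite /mr_step mr_local_gather.
by case: (j == i1); rewrite // run_bind.
Qed.

Lemma rdash_setE :
  rdash_set Alg i1 f loc pi q = if f (S i1) <= f T then T else S i1.
Proof.
by rewrite /rdash_set rdashE /= mr_step_scatter mr_step_gather eqxx.
Qed.

Lemma f_rdash_set :
  f (rdash_set Alg i1 f loc pi q) = Num.max (f T) (f (S i1)).
Proof. by rewrite rdash_setE maxC; case: leP. Qed.

Lemma mr_adaptive_rounds_rdash :
  mr_adaptive_rounds f (rdash Alg i1 pi q) (part loc) =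
  (alg_rounds Alg f pi q).+1.
Proof.
rewrite rdashE /= mr_step_scatter addn0 -addnS; congr (_ + _)%N.
  by apply: eq_bigr => j _; rewrite mr_local_scatter rounds_bind addn0.
(* In the second round only machine [i1] queries, so the maximum is attained there; its extra round
   is the comparison of [f T] with [f (S i1)]. *)
apply/eqP; rewrite eqn_leq; apply/andP; split.
  apply/bigmax_leqP => j _; rewrite mr_local_gather.
  by case: (j == i1); rewrite // rounds_bind addn1.
apply: leq_trans (leq_bigmax i1).
by rewrite mr_local_gather eqxx rounds_bind addn1.
Qed.

Lemma mr_queries_rdash :
  mr_queries f (rdash Alg i1 pi q) (part loc) = (alg_queries Alg f pi q).+2.
Proof.
rewrite rdashE /= mr_step_scatter addn0 -!addnS; congr (_ + _)%N.
  by apply: eq_bigr => j _; rewrite mr_local_scatter queries_bind addn0.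
rewrite (bigD1 i1)//= big1 => [|j /negbTE jD]; rewrite mr_local_gather ?jD//.
by rewrite eqxx queries_bind /= addn0 addn2.
Qed.

Variables (k : nat).
(** Asked of all inputs, including those on which [Alg] fails: a failed run outputs the empty set.
    The resource bounds thus hold for every [q]. *)
Hypothesis outP : forall Y, output f Alg Y q \subset Y /\
  (#|output f Alg Y q| <= k)%N.

Lemma output_sub Y : output f Alg Y q \subset Y.
Proof. by case: (outP Y). Qed.

Lemma card_output Y : (#|output f Alg Y q| <= k)%N.
Proof. by case: (outP Y). Qed.

Lemma sum_card_gather j :
  (\sum_i #|mr_inbox gather S j i| = if j == i1 then \sum_i #|S i| else 0)%N.
Proof.
rewrite mr_inbox_gather; case: (j == i1) => //.
by rewrite big1 // => i _; rewrite cards0.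
Qed.

Lemma sum_card_send_gather i :
  (\sum_j #|mr_send gather i (S i) j| = #|S i|)%N.
Proof.
rewrite /= (bigD1 i1)//= eqxx big1 ?addn0// => j /negbTE ->.
by rewrite cards0.
Qed.

Lemma card_rdash_set : (#|rdash_set Alg i1 f loc pi q| <= k)%N.
Proof. by rewrite rdash_setE; case: ifP => _; exact: card_output. Qed.

(** Each round moves every element at most once: the initial parts are disjoint, and so are the sets
    [S i], being contained in the parts of [pi]. *)
Lemma communication_rdash :
  (mr_communication f (rdash Alg i1 pi q) (part loc) <= 2 * #|N|)%N.
Proof.
rewrite rdashE /= mr_step_scatter addn0 mul2n -addnn leq_add//.
  rewrite (eq_bigr (fun i => #|part loc i|)).
    by apply: (sum_card_sub_part (pi := loc)).
  by move=> i _; rewrite sum_card_setI_part.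
under eq_bigr do rewrite sum_card_send_gather.
by apply: (sum_card_sub_part (pi := pi)) => i; exact: output_sub.
Qed.

Lemma within_rdash (m : R) :
  (forall i, #|part loc i|%:R <= m) -> (forall i, #|part pi i|%:R <= m) ->
  (l * k)%N%:R <= m -> mr_within f m (rdash Alg i1 pi q) (part loc).
Proof.
move=> locm pim lkm; have l0 : (0 < l)%N by case: (l) (i1) => [[]|].
have km (A : {set N}) : (#|A| <= k)%N -> #|A|%:R <= m.
  move=> Ak; apply: le_trans lkm; rewrite ler_nat (leq_trans Ak)//.
  exact: leq_pmull.
have m0 : 0 <= m by apply: le_trans lkm.
rewrite rdashE /= !mr_step_scatter; split=> //; split.
- by move=> i j; exact: finset.subsetIl.
- by move=> i; rewrite sum_card_setI_part.
- move=> j; rewrite /mr_inbox /=.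
  under eq_bigr do rewrite finset.setIC.
  by rewrite sum_card_setI_part.
- by move=> j; rewrite bigcup_part_setI; exact: output_sub.
split; first by move=> i; apply/km/card_output.
have Sm : (\sum_i #|S i|)%N%:R <= m.
  apply: le_trans lkm; rewrite ler_nat -[l in (l * _)%N]card_ord -sum_nat_const.
  by apply: leq_sum => i _; exact: card_output.
split.
- by move=> i j; case: (j == i1); rewrite ?finset.sub0set.
- by move=> i; rewrite sum_card_send_gather; apply/km/card_output.
- by move=> j; rewrite sum_card_gather; case: (j == i1).
- move=> j; rewrite mr_step_gather.
  case: (j == i1); last by rewrite finset.sub0set.
  case: ifP => _; first exact: output_sub.
  exact: (finset.bigcup_sup i1).
split=> // i; rewrite mr_step_gather; apply: km.
by case: (i == i1); [case: ifP => _; exact: card_output | rewrite cards0].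
Qed.

Lemma card_rdash_union : (#|rdash_union Alg f pi q| <= l * k)%N.
Proof.
apply: (@leq_trans (\sum_i #|S i|)).
  rewrite /rdash_union; elim/big_ind2: _ => [|A a B b Aa Bb|//].
    by rewrite cards0.
  by apply: leq_trans (leq_add Aa Bb); rewrite cardsU leq_subr.
rewrite -[l in (l * _)%N]card_ord -sum_nat_const.
by apply: leq_sum => i _; exact: card_output.
Qed.

(** The input of the last call has at most [l * k <= m] elements, so all [l + 1] calls have inputs
    of size at most [m]. The first [l] run in parallel and together cost one [Psi m]. *)
Lemma rdash_resourcesP (Phi Psi : R -> R) (m : R) :
  query_complexity f Alg Phi -> adaptivity f Alg Psi ->
  (forall i, #|part loc i|%:R <= m) -> (forall i, #|part pi i|%:R <= m) ->
  (l * k)%N%:R <= m -> rdash_resources Alg i1 f Phi Psi loc m pi q.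
Proof.
move=> hPhi hPsi locm pim lkm.
have Um : #|rdash_union Alg f pi q|%:R <= m.
  by apply: le_trans lkm; rewrite ler_nat card_rdash_union.
split.
- exact: within_rdash.
- rewrite /alg_rounds natrD mulr_natl mulr2n lerD ?hPsi//.
  by rewrite (bigop.bigmax_eq_arg i1)//; exact: hPsi.
- rewrite /alg_queries natrD natr_sum -addn1 natrD mulrDl mul1r lerD ?hPhi//.
  rewrite mulr_natl -[l in X in _ <= X]card_ord -sumr_const.
  by apply: ler_sum => i _; exact: hPhi.
- exact: mr_adaptive_rounds_rdash.
- exact: mr_queries_rdash.
Qed.

End RDashExecution.

(** * Expectation over a uniform assignment *)

Section Mean.
Context {R : realType} {N : finType} {l : nat}.
Variable i1 : 'I_l.
Implicit Types (X Y : assignment N l -> R).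

Lemma card_assignment_gt0 : 0 < #|{: assignment N l}|%:R :> R.
Proof. by rewrite ltr0n; apply/card_gt0P; exists [ffun=> i1]. Qed.

Lemma ler_assignment_mean X Y :
  (forall pi, X pi <= Y pi) -> assignment_mean X <= assignment_mean Y.
Proof.
by move=> XY; rewrite ler_wpM2r ?invr_ge0 ?ler0n//; apply: ler_sum => pi _.
Qed.

Lemma assignment_mean_cst (a : R) :
  assignment_mean (fun _ : assignment N l => a) = a.
Proof.
by rewrite /assignment_mean sumr_const -[a *+ _]mulr_natr mulfK ?gt_eqF//
   card_assignment_gt0.
Qed.

Lemma assignment_meanD X Y :
  assignment_mean (fun pi => X pi + Y pi) =
  assignment_mean X + assignment_mean Y.
Proof. by rewrite /assignment_mean big_split mulrDl. Qed.

Lemma assignment_meanZ (a : R) X :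
  assignment_mean (fun pi => a * X pi) = a * assignment_mean X.
Proof. by rewrite /assignment_mean -mulr_sumr mulrA. Qed.

Lemma assignment_mean_sum (I : Type) (r : seq I) (P : pred I)
    (F : I -> assignment N l -> R) :
  assignment_mean (fun pi => \sum_(i <- r | P i) F i pi) =
  \sum_(i <- r | P i) assignment_mean (F i).
Proof. by rewrite /assignment_mean exchange_big mulr_suml. Qed.

End Mean.

(** * Chernoff bound for the maximum load *)

Section MaxLoad.
Context {R : realType} {N : finType} {l : nat}.

(** The load is a sum of independent indicators, so its exponential moment is a product over the
    elements; here independence is the distributivity of a product of sums over [j] into a sum over
    assignments. *)
Lemma assignment_mean_expR_load (i : 'I_l) :
  assignment_mean (fun pi : assignment N l => expR #|part pi i|%:R : R) =
  ((l%:R - 1 + expR 1) / l%:R) ^+ #|N|.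
Proof.
rewrite /assignment_mean card_ffun card_ord natrX expr_div_n; congr (_ / _).
(* Machine [i] contributes [e], each of the [l - 1] others contributes 1. *)
have -> : l%:R - 1 + expR 1 = \sum_(j < l) expR (j == i)%:R :> R.
  rewrite (bigD1 i)//= eqxx addrC; congr (_ + _).
  rewrite (eq_bigr (fun=> 1)) => [|j /negbTE ->]; last exact: expR0.
  by rewrite sumr_const cardC1 card_ord -subn1 natrB//; case: (l) (i) => [[]|].
rewrite -prodr_const bigA_distr_bigA /=; apply: eq_bigr => pi _.
rewrite -expR_sum -natr_sum; congr (expR _%:R).
by rewrite -sum1_card big_mkcond; apply: eq_bigr => e _; rewrite inE; case: eqP.
Qed.

Lemma assignment_mean_expR_load_le (i : 'I_l) :
  assignment_mean (fun pi : assignment N l => expR #|part pi i|%:R : R) <=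
  expR ((expR 1 - 1) * (#|N|%:R / l%:R)).
Proof.
have l0 : 0 < l%:R :> R by rewrite ltr0n; case: (l) (i) => [[]|].
have e1 : 1 <= expR 1 :> R by rewrite -expR0 ler_expR.
rewrite assignment_mean_expR_load mulrCA expRM_natl.
have -> : (l%:R - 1 + expR 1) / l%:R = 1 + (expR 1 - 1) / l%:R :> R.
  by rewrite -addrA mulrDl divff ?gt_eqF// [- 1 + _]addrC.
apply: lerXn2r; rewrite ?nnegrE ?expR_ge0 ?expR_ge1Dx//.
Qed.

(** With [mu = n / l] and [s = sqrt n], one machine is overloaded with probability at most [exp((e -
    1 - K) mu) <= exp(-3 mu) <= s^-3], and there are at most [s] machines. *)
Lemma max_load (K : R) : (0 < #|N|)%N -> l%:R <= Num.sqrt #|N|%:R :> R ->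
  expR 1 + 2 <= K ->
  assignment_mean (fun pi : assignment N l =>
    [exists i, K * (#|N|%:R / l%:R) < #|part pi i|%:R]%:R : R) <= #|N|%:R^-1.
Proof.
move=> N0; set s := Num.sqrt _ => ls hK.
set mu := #|N|%:R / l%:R.
have s2 : #|N|%:R = s ^+ 2 by rewrite sqr_sqrtr.
have s0 : 0 < s by rewrite sqrtr_gt0 ltr0n.
have [->|l0] := posnP l.
  rewrite /assignment_mean big1 ?mul0r ?invr_ge0// => pi _.
  by case: existsP => // -[[]].
have lR : 0 < l%:R :> R by rewrite ltr0n.
have smu : s <= mu by rewrite /mu ler_pdivlMr// s2 expr2 ler_pM2l.
(* Markov and union bound at once: an overloaded machine contributes a term [exp(load - K mu) >= 1],
   and all terms are nonnegative. *)
apply: (@le_trans _ _ (assignment_mean (fun pi : assignment N l =>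
    \sum_(i < l) expR (- (K * mu)) * expR #|part pi i|%:R))).
  apply: ler_assignment_mean => pi; case: existsP => [[i Ki]|_]; last first.
    by apply: sumr_ge0 => i _; rewrite mulr_ge0 ?expR_ge0.
  rewrite (bigD1 i)//= -[leLHS]addr0 lerD//.
    by rewrite -expRD -[leLHS]expR0 ler_expR addrC subr_ge0 ltW.
  by apply: sumr_ge0 => j _; rewrite mulr_ge0 ?expR_ge0.
rewrite assignment_mean_sum.
apply: (@le_trans _ _ (\sum_(i < l) s^-1 ^+ 3)).
  apply: ler_sum => i _; rewrite assignment_meanZ.
  apply: le_trans (ler_wpM2l (expR_ge0 _) (assignment_mean_expR_load_le i)) _.
  rewrite -expRD -/mu -mulNr -mulrDl.
  (* The threshold [e + 2] for [K] is chosen so that [K - (e - 1) >= 3]; then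
     [exp mu >= 1 + mu >= s] turns the bound into [s^-3]. *)
  apply: (@le_trans _ _ (expR (3%:R * - mu))).
    rewrite ler_expR mulrN -mulNr ler_wpM2r//; last by lra.
    exact: le_trans (ltW s0) smu.
  rewrite expRM_natl expRN lerXn2r ?nnegrE ?invr_ge0 ?expR_ge0 ?(ltW s0)//.
  rewrite lef_pV2 ?posrE ?expR_gt0//; apply: le_trans smu _.
  by apply: le_trans (expR_ge1Dx _); rewrite lerDr.
rewrite sumr_const card_ord s2 -exprVn -mulr_natl exprS mulrA.
by rewrite ler_piMl ?exprn_ge0 ?invr_ge0 ?(ltW s0)// ler_pdivrMr// mul1r.
Qed.

End MaxLoad.

(** * Modular minorants and random subsets of a fixed set *)

Section Submodular.
Context {R : realType} {N : finType}.
Variable f : {set N} -> R.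

(* For a fixed ordering of O, g o is the marginal of o over its predecessors. *)
Lemma submodular_modular_minorant (O : {set N}) : submodular f ->
  exists g : N -> R, f O = f finset.set0 + \sum_(o in O) g o /\
    forall A : {set N}, A \subset O -> f finset.set0 + \sum_(o in A) g o <= f A.
Proof.
move=> sub; move En : #|O| => n; elim: n O En => [|n IH] O.
  move=> /eqP; rewrite cards_eq0 => /eqP ->; exists (fun=> 0).
  split; first by rewrite big1 ?addr0.
  by move=> A; rewrite finset.subset0 => /eqP ->; rewrite big1 ?addr0.
move=> On; have [x xO] : exists x, x \in O by apply/card_gt0P; rewrite On.
have [g [gO gA]] : exists g : N -> R,
    f (O :\ x) = f finset.set0 + \sum_(o in O :\ x) g o /\
    forall A : {set N}, A \subset O :\ x ->
      f finset.set0 + \sum_(o in A) g o <= f A.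
  by apply: IH; apply: succn_inj; rewrite -On [RHS](cardsD1 x) xO.
(* The removed element [x] comes last in the ordering of [O]. *)
pose g' o := if o == x then f O - f (O :\ x) else g o.
have g'E (A : {set N}) : x \notin A -> \sum_(o in A) g' o = \sum_(o in A) g o.
  move=> xA; apply: eq_bigr => o oA; rewrite /g'; case: eqP => // ox.
  by rewrite -ox oA in xA.
have g'D (A : {set N}) : x \in A ->
    \sum_(o in A) g' o = f O - f (O :\ x) + \sum_(o in A :\ x) g o.
  move=> xA; rewrite (big_setD1 x)//= g'E ?setD11//.
  by rewrite /g' eqxx.
exists g'; split.
  by rewrite g'D// gO; lra.
move=> A AO; have [xA|xA] := boolP (x \in A); last first.
  by rewrite g'E// gA// subsetD1 AO.
have AOx : A :\ x \subset O :\ x by exact: finset.setSD.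
(* The marginal of [x] over [A :\ x] is at least its marginal over [O :\ x], which is [g' x]. *)
have := sub _ _ x AOx; rewrite setD11 !finset.setD1K// => /(_ isT).
by have := gA _ AOx; rewrite g'D//; lra.
Qed.

Lemma le_opt_on k (Y Z : {set N}) :
  Z \subset Y -> (#|Z| <= k)%N -> f Z <= opt_on f k Y.
Proof. by move=> ZY Zk; apply: le_bigmax_cond; rewrite ZY. Qed.

Context {l : nat}.
Variable i1 : 'I_l.

(** The mean of a modular minorant depends only on the probabilities of the events [o \in X pi],
    whatever the dependence between elements. These sum to exactly 1 over [A] and [B], which matters
    since [g o] can have either sign. *)
Lemma submodular_random_cover (O : {set N}) (A B : assignment N l -> {set N}) :
  (forall S, 0 <= f S) -> submodular f ->
  (forall pi, A pi \subset O) -> (forall pi, B pi \subset O) ->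
  (forall o, o \in O -> assignment_mean (fun pi => (o \in A pi)%:R : R) +
     assignment_mean (fun pi => (o \in B pi)%:R) = 1) ->
  f O <= assignment_mean (fun pi => f (A pi)) +
         assignment_mean (fun pi => f (B pi)).
Proof.
move=> f0 sub AO BO AB; have [g [gO gle]] := submodular_modular_minorant O sub.
have mean_ge (X : assignment N l -> {set N}) : (forall pi, X pi \subset O) ->
    f finset.set0 + \sum_(o in O)
      g o * assignment_mean (fun pi => (o \in X pi)%:R) <=
    assignment_mean (fun pi => f (X pi)).
  move=> XO; rewrite -[f finset.set0](assignment_mean_cst (N:=N) i1).
  under eq_bigr do rewrite -assignment_meanZ.
  rewrite -assignment_mean_sum -assignment_meanD.
  apply: ler_assignment_mean => pi; apply: le_trans (gle _ (XO pi)).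
  rewrite lerD2l (big_setID (X pi))/= [X in _ + X]big1 ?addr0; last first.
    by move=> o /setDP[_ /negbTE ->]; rewrite mulr0.
  rewrite (finset.setIidPr (XO pi)) le_eqVlt; apply/orP; left; apply/eqP.
  by apply: eq_bigr => o ->; rewrite mulr1.
apply: le_trans (lerD (mean_ge A AO) (mean_ge B BO)).
rewrite addrACA -big_split/= (eq_bigr g); last first.
  by move=> o oO; rewrite -mulrDr AB// mulr1.
(* The value at the empty set is counted twice; the surplus copy is nonnegative. *)
by rewrite gO lerD2r lerDl.
Qed.

End Submodular.

(** * The approximation guarantee for fixed random bits *)

Section Approximation.
Context {R : realType} {N : finType} {l : nat} {Q : Type}.
Variables (f : {set N} -> R) (Alg : rand_alg N R Q) (i1 : 'I_l).
Variables (loc : assignment N l) (k : nat) (alpha : R) (q : Q).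

(* Exchanging machines i1 and pi o for all elements but o is a measure
   preserving involution, which turns the machine holding o into o |: N_1. *)
Lemma assignment_mean_own_machine (out : {set N} -> {set N}) (o : N) :
  assignment_mean (fun pi : assignment N l =>
    (o \in out (part pi (pi o)))%:R : R) =
  assignment_mean (fun pi => (o \in out (o |: part pi i1))%:R).
Proof.
(* The element [o] itself stays put, so [swap pi] uses the same transposition as [pi], whence the
   involution. *)
pose swap (pi : assignment N l) : assignment N l :=
  [ffun e => if e == o then pi o else tperm (pi o) i1 (pi e)].
have swapo pi : swap pi o = pi o by rewrite ffunE eqxx.
have swapK : involutive swap.
  move=> pi; apply/ffunP => e; rewrite ffunE swapo ffunE.
  by case: eqP => [->//|_]; rewrite tpermK.
rewrite /assignment_mean; congr (_ / _).
rewrite [RHS](reindex_inj (inv_inj swapK)); apply: eq_bigr => pi _ /=.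
(* For [x] other than [o], [swap pi x = i1] exactly when [pi x = pi o]. *)
congr (o \in out _)%:R; apply/setP => x; rewrite !inE ffunE.
have [->|_] := eqVneq x o; first by rewrite eqxx.
by rewrite -[X in _ || (_ == X)](tpermL (pi o) i1) (inj_eq perm_inj).
Qed.

Hypothesis f_ge0 : forall A, 0 <= f A.
Hypothesis f_submod : submodular f.
Hypothesis Alg_consistent : randomized_consistency f Alg.
Hypothesis Alg_approx : approx_ratio f Alg k alpha.
Hypothesis Alg_succeeds : forall Y, succeeds f Alg Y q.

Let out Y := output f Alg Y q.

Lemma le_output (Y Z : {set N}) : 0 <= alpha ->
  Z \subset Y -> (#|Z| <= k)%N -> alpha * f Z <= f (out Y).
Proof.
move=> a0 ZY Zk; have [_ _] := Alg_approx (Alg_succeeds Y).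
by apply: le_trans; rewrite ler_wpM2l// le_opt_on.
Qed.

(** By consistency the output on [A] is also the output on [A] enlarged by [Z], where [Z] is a
    feasible candidate. Passing to [Z :\: A] supplies the disjointness that consistency asks for. *)
Lemma le_output_unselected (A Z : {set N}) : 0 <= alpha -> (#|Z| <= k)%N ->
  (forall z, z \in Z -> z \notin out (z |: A)) -> alpha * f Z <= f (out A).
Proof.
move=> a0 Zk Zout.
have dis : [disjoint A & Z :\: A].
  by rewrite -setI_eq0; apply/eqP/setP => x; rewrite !inE; case: (x \in A).
have Zout' b : b \in Z :\: A -> b \notin output f Alg (b |: A) q.
  by case/setDP => bZ _; exact: Zout.
have [_ AZ] := Alg_consistent dis Zout' (Alg_succeeds A).
rewrite /out -AZ.
apply: le_output => //; apply/fintype.subsetP => x xZ.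
by rewrite !inE xZ; case: (x \in A).
Qed.

Lemma assignment_mean_rdash_set (O : {set N}) :
  0 <= alpha -> (#|O| <= k)%N ->
  alpha / 2 * f O <=
    assignment_mean (fun pi => f (rdash_set Alg i1 f loc pi q)).
Proof.
move=> a0 Ok.
pose A (pi : assignment N l) := [set o in O | o \in out (part pi (pi o))].
pose B pi := [set o in O | o \notin out (o |: part pi i1)].
have AO pi : A pi \subset O by apply/fintype.subsetP => x; rewrite inE => /andP[].
have BO pi : B pi \subset O by apply/fintype.subsetP => x; rewrite inE => /andP[].
have cover : f O <= assignment_mean (fun pi => f (A pi)) +
                    assignment_mean (fun pi => f (B pi)).
  apply: (submodular_random_cover i1) => // o oO.
  have -> : (fun pi => (o \in A pi)%:R) =
      (fun pi => (o \in out (part pi (pi o)))%:R : R).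
    by apply/funext => pi; rewrite inE oO.
  (* After the exchange of machines both events concern [o |: part pi i1], and they are
     complementary. *)
  rewrite assignment_mean_own_machine -assignment_meanD.
  rewrite -[RHS](assignment_mean_cst (N:=N) i1); congr assignment_mean.
  apply/funext => pi; rewrite inE oO /=.
  by case: (o \in _); rewrite ?addr0 ?add0r.
apply: le_trans (_ : assignment_mean (fun pi =>
    alpha / 2 * (f (A pi) + f (B pi))) <= _).
  rewrite assignment_meanZ assignment_meanD ler_wpM2l ?divr_ge0//.
(* The factor 1/2 is lost here: the maximum of [f T] and [f S_1] is at least their average. *)
apply: ler_assignment_mean => pi; rewrite f_rdash_set.
have fA : alpha * f (A pi) <= f (output f Alg (rdash_union Alg f pi q) q).
  apply: le_output => //; last by rewrite (leq_trans (subset_leq_card (AO pi))).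
  apply/fintype.subsetP => o; rewrite inE => /andP[_ oout].
  by apply/bigcupP; exists (pi o).
have fB : alpha * f (B pi) <= f (out (part pi i1)).
  apply: le_output_unselected => //.
    by rewrite (leq_trans (subset_leq_card (BO pi))).
  by move=> z; rewrite inE => /andP[].
rewrite -/(out _) in fA *; rewrite le_max.
by case: (leP (f (out (part pi i1))) (f (out (rdash_union Alg f pi q)))) => h;
   apply/orP; [left|right]; lra.
Qed.

Lemma assignment_mean_rdash_opt : 0 <= alpha ->
  alpha / 2 * opt f k <=
    assignment_mean (fun pi => f (rdash_set Alg i1 f loc pi q)).
Proof.
move=> a0; rewrite /opt /opt_on; elim/big_ind: _ => [|x y hx hy|O /andP[_ Ok]].
(* The bound is proved for each candidate in the maximum; the base value 0 is covered by
   nonnegativity of [f]. *)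
- rewrite mulr0 -(assignment_mean_cst (N:=N) i1 0).
  exact: ler_assignment_mean.
- by rewrite maxElt; case: ifP.
- exact: assignment_mean_rdash_set.
Qed.

End Approximation.

(** * Measurability in the random bits *)

Section Measurability.
Context d (Q : measurableType d) (R : realType).

(** A preimage is the finite union, over the tables [t] with [h t] in [Y], of the finite
    intersections of the events [u i q = t i]. The intersection is written as the complement of a
    union of complements. *)
Lemma measurable_finite_factor (I T : finType) (u : I -> Q -> T)
    (h : {ffun I -> T} -> R) :
  (forall i t, measurable [set q | u i q = t]%classic) ->
  measurable_fun setT (fun q => h [ffun i => u i q]).
Proof.
move=> mu _ Y _; rewrite setTI.
rewrite (_ : (_ @^-1` _)%classic = (\bigcup_(t in [set t | Y (h t)])
   ~` \bigcup_(i in setT) ~` [set q | u i q = t i])%classic).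
  apply: fin_bigcup_measurable => [|t _]; first exact: finite_finset.
  apply: measurableC; apply: fin_bigcup_measurable => [|i _].
    exact: finite_finset.
  exact: measurableC.
apply/seteqP; split => [q Yq|q [t Yt ut]] /=.
  exists [ffun i => u i q] => // -[i _]; apply; rewrite /= ffunE//.
suff -> : [ffun i => u i q] = t by [].
apply/ffunP => i; rewrite ffunE; apply: contrapT => uit.
by apply: ut; exists i.
Qed.

Lemma measurable_rdash_mean (N : finType) (l : nat) (f : {set N} -> R)
    (Alg : rand_alg N R Q) (i1 : 'I_l) (loc : assignment N l) :
  (forall (Y : {set N}) (o : option {set N}),
     measurable [set q | run f (Alg Y q) = o]%classic) ->
  measurable_fun setT (fun q =>
    assignment_mean (fun pi => f (rdash_set Alg i1 f loc pi q))).
Proof.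
move=> mAlg.
pose out (t : {ffun {set N} -> option {set N}}) Y := odflt finset.set0 (t Y).
(* The mean depends on [q] only through the finite table of the results of [Alg] on all input
   sets. *)
pose h t : R := assignment_mean (fun pi : assignment N l =>
  let T := out t (\bigcup_i out t (part pi i)) in let S1 := out t (part pi i1) in
  f (if f S1 <= f T then T else S1)).
rewrite (_ : (fun q => _) = fun q => h [ffun Y => run f (Alg Y q)]).
  exact: (measurable_finite_factor (u := fun Y q => run f (Alg Y q))).
apply/funext => q; congr assignment_mean; apply/funext => pi.
have oE Y : out [ffun Y => run f (Alg Y q)] Y = output f Alg Y q.
  by rewrite /out ffunE.
have UE : \bigcup_i out [ffun Y => run f (Alg Y q)] (part pi i) =
    rdash_union Alg f pi q by apply: eq_bigr => i _; exact: oE.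
by rewrite rdash_setE UE !oE.
Qed.

End Measurability.

(** * Choice of the constant and passage to random bits that succeed almost surely *)

Theorem theorem3 (R : realType) (C : R) :
  exists K : R,
  forall (N : finType) (f : {set N} -> R) (k l psi : nat) (c alpha : R)
    (i1 : 'I_l) (loc : assignment N l)
    (d : measure_display) (Q : measurableType d) (P : probability Q R)
    (Alg : rand_alg N R Q) (Phi Psi : R -> R),
  (forall A : {set N}, 0 <= f A) ->
  monotone_set_fun f ->
  submodular f ->
  (forall i : 'I_l, (#|part loc i| <= psi)%N) ->
  (psi * l)%N%:R <= C * #|N|%:R ->
  2^-1 <= c ->
  l%:R <= #|N|%:R `^ (1 - c) ->
  k%:R < psi%:R / l%:R :> R ->
  (forall (Y : {set N}) (o : option {set N}),
     measurable [set q | run f (Alg Y q) = o]%classic) ->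
  randomized_consistency f Alg ->
  approx_ratio f Alg k alpha ->
  (forall Y : {set N}, {ae P, forall q, succeeds f Alg Y q}) ->
  query_complexity f Alg Phi ->
  adaptivity f Alg Psi ->
  let n_l := #|N|%:R / l%:R in
  [/\ forall pi q,
        [/\ size (rdash Alg i1 pi q) = 2%N,
            (mr_communication f (rdash Alg i1 pi q) (part loc))%:R
              <= K * #|N|%:R
          & (#|rdash_set Alg i1 f loc pi q| <= k)%N],
      forall (m : R) pi q,
        psi%:R <= m -> (forall i, #|part pi i|%:R <= m) ->
        rdash_resources Alg i1 f Phi Psi loc m pi q,
      1 - #|N|%:R^-1 <= assignment_prob (fun pi =>
        forall q, rdash_resources Alg i1 f Phi Psi loc (K * n_l) pi q) :> R
    & ((alpha / 2 * opt f k)%:E <= 'E_P[fun q =>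
        assignment_mean (fun pi => f (rdash_set Alg i1 f loc pi q))])%E].

Proof.
(* The constant must exceed 2 for communication, [C] for the capacity [psi], and [e + 2] for the
   maximum load. *)
exists (`|C| + expR 1 + 2).
move=> N f k l psi c alpha i1 loc d Q P Alg Phi Psi f0 _ fsub locpsi Cn c2 ln kpsi.
move=> mAlg cons appr succ hPhi hPsi n_l.
have l0 : (0 < l)%N by case: (l) (i1) => [[]|].
have lR : 0 < l%:R :> R by rewrite ltr0n.
have lk : (l * k <= psi)%N.
  rewrite -(ler_nat R) natrM mulrC -ler_pdivlMr//; exact: ltW.
have psi0 : (0 < psi)%N.
  have : 0 < psi%:R / l%:R :> R by apply: le_lt_trans kpsi; rewrite ler0n.
  by rewrite pmulr_lgt0 ?invr_gt0// ltr0n.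
(* An empty ground set would force [psi * l = 0]. *)
have N0 : (0 < #|N|)%N.
  rewrite lt0n; apply/eqP => Nz; move: Cn; rewrite Nz mulr0 lern0.
  by rewrite muln_eq0 !eqn0Ngt psi0 l0.
have outP q Y : output f Alg Y q \subset Y /\ (#|output f Alg Y q| <= k)%N.
  have [sY|] := boolP (succeeds f Alg Y q); first by case: (appr _ _ sY).
  rewrite /succeeds /output; case: (run _ _) => //= _.
  by rewrite finset.sub0set cards0.
have ge2 : expR 1 + 2 <= `|C| + expR 1 + 2 by rewrite -addrA lerDr.
have e0 : 0 <= expR 1 :> R by exact: expR_ge0.
have C0 : 0 <= `|C| by [].
split.
- move=> pi q; split=> //; last exact: card_rdash_set.
  apply: (@le_trans _ _ (2 * #|N|)%N%:R).
    by rewrite ler_nat; exact: communication_rdash.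
  by rewrite natrM ler_wpM2r//; lra.
- move=> m pi q psim pim; apply: (rdash_resourcesP i1 (outP q)) => //.
    by move=> i; apply: le_trans psim; rewrite ler_nat.
  by apply: le_trans psim; rewrite ler_nat.
- set K := `|C| + _ + _ in ge2 *.
  have psiK : psi%:R <= K * n_l.
    rewrite /n_l mulrA ler_pdivlMr// -natrM; apply: le_trans Cn _.
    rewrite ler_wpM2r//; apply: le_trans (ler_norm C) _.
    by rewrite /K; lra.
  (* Here [c >= 1/2] gives [1 - c <= 1/2]. *)
  have lsqrt : l%:R <= Num.sqrt #|N|%:R :> R.
    rewrite -powR12_sqrt//; apply: le_trans ln _.
    by rewrite ler_powR ?ler1n//; lra.
  pose bad (pi : assignment N l) := [exists i, K * n_l < #|part pi i|%:R].
  have pbad : assignment_mean (fun pi => (bad pi)%:R : R) <= #|N|%:R^-1.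
    exact: max_load.
  rewrite lerBlDl -[leLHS](assignment_mean_cst (N:=N) i1).
  (* Every assignment is either overloaded or meets the resource bounds for all [q]. *)
  apply: (@le_trans _ _ (assignment_mean (fun pi => (bad pi)%:R : R) +
     assignment_prob (fun pi =>
       forall q, rdash_resources Alg i1 f Phi Psi loc (K * n_l) pi q))).
    rewrite /assignment_prob -assignment_meanD.
    apply: ler_assignment_mean => pi.
    have [_|/negP ngood] := boolP (bad pi); first by rewrite lerDl ler0n.
    rewrite add0r asboolT// => q; apply: (rdash_resourcesP i1 (outP q)) => //.
    + by move=> i; apply: le_trans psiK; rewrite ler_nat.
    + by move=> i; rewrite leNgt; apply/negP => Ki; apply: ngood; apply/existsP; exists i.
    + by apply: le_trans psiK; rewrite ler_nat.
  by rewrite lerD2r.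
(* A negative ratio makes the left side at most 0, while the expectation is nonnegative. *)
- have [a0|a0] := ltP alpha 0.
    apply: (@le_trans _ _ 0%E).
      rewrite lee_fin mulr_le0_ge0//; first by lra.
      by rewrite /opt /opt_on; apply: bigmax_ge_id.
    apply: expectation_ge0 => q; rewrite -(assignment_mean_cst (N:=N) i1 0).
    exact: ler_assignment_mean.
  rewrite -(expectation_cst P); apply: expectation_le.
  + exact: measurable_cst.
  + exact: measurable_rdash_mean.
  + by move=> q; rewrite /= mulr_ge0 ?divr_ge0//; exact: bigmax_ge_id.
  + move=> q; rewrite -(assignment_mean_cst (N:=N) i1 0).
    exact: ler_assignment_mean.
  (* There are finitely many input sets, so almost surely [Alg] succeeds on all of them for the same
     [q]. *)
  + have : {ae P, forall q Y, succeeds f Alg Y q} by exact: filter_forall.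
    apply: filterS => q sq.
    exact: (assignment_mean_rdash_opt _ _ f0 fsub cons appr sq).
Qed.
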